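(* Let $A,B>0$ be constants such that every tight frame of vectors in the unit ball of a finite dimensional Hilbert space with frame bound greater than $1$ can be partitioned into a collection of frames of that space, each with lower frame bound $A$ and upper frame bound $B$. Then every tight frame of vectors in the unit ball of a separable Hilbert space $H$ with frame bound greater than $1$ can be partitioned into a finite collection of frames of $H$, each with lower frame bound $A$ and upper frame bound $B$.
   Context: A collection $(x_j)_{j\in J}$ of vectors in a Hilbert space $H$, indexed by a countable set $J$, is a frame of $H$ with lower frame bound $a>0$ and upper frame bound $b>0$ if $a\|x\|^2\le\sum_{j\in J}|\langle x,x_j\rangle|^2\le b\|x\|^2$ for all $x\in H$. It is a tight frame with frame bound $K$ if one may take $a=b=K$. Partitioning $(x_j)_{j\in J}$ into frames means partitioning the index set $J$ into sets $J_i$ such that each $(x_j)_{j\in J_i}$ is a frame of $H$. The unit ball of $H$ is $\{x\in H:\|x\|\le1\}$. Universal constants $A,B>0$ with the stated finite dimensional property (the same for all finite dimensional spaces and all such frames) are known to exist. *)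

(* Defs.v *)
From HB Require Import structures.
From mathcomp Require Import all_boot all_order all_algebra.
From mathcomp Require Import sesquilinear complex.
From mathcomp Require Import all_classical all_reals all_analysis.

Set Implicit Arguments.
Unset Strict Implicit.
Unset Printing Implicit Defensive.
Import Order.TTheory GRing.Theory Num.Theory.
Import numFieldNormedType.Exports.
Local Open Scope classical_set_scope.
Local Open Scope ring_scope.
Local Open Scope complex_scope.

(* Hilbert spaces are real or complex: the scalar field K is R or R[i], [conj]
   is its conjugation and [re] its real part.  Norms and moduli on R[i] take
   their values in R[i]; [re] turns these (real) values into elements of R. *)
Variant real_or_complex (R : realType) :
    forall K : numFieldType, (K -> K) -> (K -> R) -> Prop :=
| RealScalars : @real_or_complex R R idfun idfun
| ComplexScalars : @real_or_complex R R[i] Num.conj (@complex.Re R).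

(* A Hilbert space over K is a [completeNormedModType K] whose norm comes from
   an inner product, linear in its first argument. *)
Definition hilbert (K : numFieldType) (conj : K -> K)
    (H : completeNormedModType K) (dot : {dot H for conj}) : Prop :=
  forall v : H, `|v| ^+ 2 = dot v v.

Definition finite_dimensional (K : numFieldType) (V : lmodType K) : Prop :=
  exists (n : nat) (e : 'I_n -> V),
    forall v : V, exists c : 'I_n -> K, v = \sum_(i < n) c i *: e i.

Definition separable (T : topologicalType) : Prop :=
  exists2 D : set T, countable D & dense D.

Section Frames.
Variables (R : realType) (K : numFieldType) (conj : K -> K) (re : K -> R).
Variables (H : completeNormedModType K) (dot : {dot H for conj}).
Variables (J : countType) (x : J -> H).

Definition frame_on (S : set J) (a b : R) : Prop :=
  [/\ 0 < a, 0 < b &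
    forall v : H,
      let s := (\esum_(j in S) (re (`|dot v (x j)| ^+ 2))%:E)%E in
      ((a * re (`|v| ^+ 2))%:E <= s)%E /\ (s <= (b * re (`|v| ^+ 2))%:E)%E].

Definition tight_frame (k : R) : Prop := frame_on [set: J] k k.

Definition in_unit_ball : Prop := forall j : J, `|x j| <= 1.

Definition partition_into_frames (P : set (set J)) (a b : R) : Prop :=
  partition P id [set: J] /\ forall S, P S -> frame_on S a b.

End Frames.

(* Main.v *)
Require Import Defs.
From HB Require Import structures.
From mathcomp Require Import all_boot all_order all_algebra.
From mathcomp Require Import sesquilinear complex.
From mathcomp Require Import finmap.
From mathcomp Require Import all_classical all_reals all_analysis.
Import Order.TTheory GRing.Theory Num.Theory.
Import numFieldNormedType.Exports.
Local Open Scope classical_set_scope.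
Local Open Scope ring_scope.

(** The frame is pushed down to finite dimensional subspaces, split there, and
    the splittings are glued together by compactness.

    Let [p] be an orthogonal projection of finite rank.  On the range of [p]
    one has <v, p (x_j)> = <v, x_j>, so the vectors [p (x_j)] form a tight frame
    of that range with the bound [k] of the original frame, and they stay in the
    unit ball.  The finite dimensional property then yields a partition of [J]
    whose blocks satisfy both frame inequalities for every vector of the range
    ([fixed_partition]).  As every finite set of vectors lies in the range of
    such a projection ([orth_proj_fixing]), every finite set of vectors [s] has
    a partition of [J] that is good for all vectors of [s].

    The finite sets [s] are directed by inclusion, and an ultrafilter finer than
    this direction defines a limit partition: two indices lie in the same block
    when they do so for almost all [s].  On a finite set of indices the limit
    block of [j] coincides with the block of [j] for almost all [s].  The upper
    inequality passes to the limit since it only involves finite partial sums;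
    the lower one because the full series converges, so that its tail is
    small uniformly over all blocks ([partition_compactness]).  Every vector is
    covered, because it belongs to almost all [s].

    Finally, for a nonzero [v], each block carries at least [A |v|^2] of the
    total [k |v|^2], so there are finitely many blocks
    ([finite_partition_esum]). *)

(** * Inner products *)

Section InnerProduct.
Context {K : numFieldType} {conj : K -> K}.
Context {H : completeNormedModType K} {dot : {dot H for conj}}.

Lemma dot0l u : dot 0 u = 0.
Proof. by rewrite -(subrr 0) zmod_morphisml_subproof subrr. Qed.

Lemma dot0r u : dot u 0 = 0.
Proof. by rewrite raddf0. Qed.

(** The function [conj] vanishes at 0 because [dot], which is additive on both
    sides, satisfies [dot 0 0 = conj (dot 0 0)]. *)
Lemma dot_sym0 u v : dot u v = 0 -> dot v u = 0.
Proof.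
have herm x y : dot x y = conj (dot y x).
  by rewrite (hermitian_subproof x y) expr0 mul1r.
by move=> uv0; rewrite herm uv0 -(dot0r 0) -herm.
Qed.

Lemma dotDl x y z : dot (x + y) z = dot x z + dot y z.
Proof.
have h a b : dot (a - b) z = dot a z - dot b z := zmod_morphisml_subproof z a b.
by rewrite -{1}[y]opprK h -(sub0r y) h dot0l sub0r opprK.
Qed.

Lemma dotDr x y z : dot z (x + y) = dot z x + dot z y.
Proof. exact: raddfD. Qed.

Lemma pythagoras (hilbertH : hilbert dot) (u v : H) :
  dot u v = 0 -> `|u + v| ^+ 2 = `|u| ^+ 2 + `|v| ^+ 2.
Proof.
move=> uv; rewrite !hilbertH dotDl !dotDr uv (dot_sym0 _ _ uv).
by rewrite addr0 add0r.
Qed.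

End InnerProduct.

(** * Orthogonal projections of finite rank *)

Section Projections.
Context {K : numFieldType} {conj : K -> K}.
Context {H : completeNormedModType K} (dot : {dot H for conj}).

(** Orthogonality of the residual [u - p u] to the range is all that is asked:
    for linear [p] it implies idempotence and self-adjointness. *)
Definition orth_proj (p : H -> H) := forall u v, dot (u - p u) (p v) = 0.

Definition finite_rank (p : H -> H) := exists n (e : 'I_n -> H),
  forall v, exists c : 'I_n -> K, p v = \sum_(i < n) c i *: e i.

(** One step of the Gram-Schmidt process: the projection onto the line of the
    residual [w = u - p u] is added to [p].  Dividing by [dot w w] rather
    than normalizing [w] avoids square roots and the case where [u] is already in
    the range of [p]: then [w = 0] and the added term vanishes. *)
Lemma orth_proj_extend (p : {linear H -> H}) (u : H) :
  orth_proj p -> finite_rank p ->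
  exists q : {linear H -> H},
    [/\ orth_proj q, finite_rank q, q u = u & forall v, p v = v -> q v = v].
Proof.
move=> orth [n [e pe]].
pose w := u - p u.
have pw0 v : dot (p v) w = 0 by apply: dot_sym0; exact: orth.
have dotw v : dot (v - p v) w = dot v w.
  by rewrite -[in RHS](subrK (p v) v) [RHS]dotDl pw0 addr0.
have uw : dot u w = dot w w by rewrite -dotw.
pose coef v := dot v w / dot w w.
have coefK v : coef v * dot w w = dot v w.
  have [w0|w0] := eqVneq w 0; first by rewrite /coef w0 !dot0r mulr0.
  by rewrite divfK// gt_eqF// neq0_dnorm_gt0.
pose qf v := p v + coef v *: w.
have qlin : linear qf.
  move=> c x y; rewrite /qf /coef dotDl (linearl_subproof w) linearP mulrDl.
  by rewrite /= -mulrA scalerDl [c *: (p x + _)]scalerDr scalerA addrACA.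
pose q : {linear H -> H} := HB.pack qf (GRing.isLinear.Build _ _ _ _ qf qlin).
exists q; split.
- move=> x y; have xw : dot (x - qf x) w = 0.
    rewrite /qf opprD addrA -scaleNr dotDl (linearl_subproof w) /= dotw.
    by rewrite mulNr coefK subrr.
  rewrite /= {2}/qf dotDr (linearr_subproof (x - qf x)) /= xw mulr0 addr0.
  rewrite /qf opprD addrA -scaleNr dotDl.
  have -> : dot (x - p x) (p y) = 0 by exact: orth.
  have -> : dot (- coef x *: w) (p y) = - coef x * dot w (p y).
    exact: linearl_subproof.
  have -> : dot w (p y) = 0 by exact: orth.
  by rewrite mulr0 addr0.
- exists n.+1, (fun i => oapp e w (unlift ord0 i)) => v; have [c pv] := pe v.
  exists (fun i => oapp c (coef v) (unlift ord0 i)).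
  rewrite big_ord_recl unlift_none /= addrC /qf pv; congr (_ + _).
  by apply: eq_bigr => i _; rewrite liftK.
- rewrite /= /qf /coef uw; have [w0|w0] := eqVneq w 0.
    by rewrite w0 scaler0 addr0; apply/esym/eqP; rewrite -subr_eq0 -/w w0.
  by rewrite divff ?gt_eqF ?neq0_dnorm_gt0// scale1r addrC subrK.
- by move=> v pv; rewrite /= /qf pv /coef -pv pw0 mul0r scale0r addr0.
Qed.

Lemma orth_proj_fixing (s : seq H) :
  exists p : {linear H -> H},
    [/\ orth_proj p, finite_rank p & forall v, v \in s -> p v = v].
Proof.
elim: s => [|u s [p [orth fin ps]]].
  exists (\0 : {linear H -> H}); split => // [u v|]; first exact: dot0r.
  exists 0%N, (fun=> 0) => v; exists (fun=> 0).
  by rewrite big_ord0.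
have [q [qorth qfin qu qp]] := orth_proj_extend _ u orth fin.
exists q; split => // v; rewrite inE => /predU1P[->//|/ps]; exact: qp.
Qed.

End Projections.

(** * The range of an orthogonal projection as a Hilbert space *)

Section FixedSpace.
Context {K : numFieldType} {conj : K -> K}.
Context {H : completeNormedModType K} {dot : {dot H for conj}}.
Context {p : {linear H -> H}}.
Hypotheses (hilbertH : hilbert dot) (p_orth : orth_proj dot p).

(** The vector [p v - p (p v)] is orthogonal to the range of [p], as a residual,
    and lies in it, as the value of [p] at [v - p v]. *)
Lemma orth_proj_idem v : p (p v) = p v.
Proof.
apply/eqP; rewrite eq_sym -subr_eq0 -normr_eq0 -sqrf_eq0.
by rewrite hilbertH -{2}linearB p_orth.
Qed.

Lemma orth_proj_le v : `|p v| <= `|v|.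
Proof.
rewrite -(@ler_pXn2r _ 2)// ?nnegrE// -{2}(subrK (p v) v).
by rewrite (pythagoras hilbertH)// lerDr exprn_ge0.
Qed.

(** The range of [p], as a boolean predicate: a subtype of [H] can be built on it
    and inherits the vector space structure. *)
Definition fixed_pred : {pred H} := fun v => p v == v.

Lemma fixed_submod_closed : submod_closed fixed_pred.
Proof.
split; first by rewrite unfold_in linear0.
by move=> c u v; rewrite !unfold_in linearP => /eqP -> /eqP ->.
Qed.

HB.instance Definition _ :=
  GRing.isSubmodClosed.Build K H fixed_pred fixed_submod_closed.

Record fixed_space : predArgType :=
  FixedPoint { fixed_val : H; _ : fixed_val \in fixed_pred }.

HB.instance Definition _ := [isSub for fixed_val].
HB.instance Definition _ := [Choice of fixed_space by <:].
HB.instance Definition _ := [SubChoice_isSubLmodule of fixed_space by <:].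

Let norm (v : fixed_space) : K := `|val v|.

Let norm_triangle u v : norm (u + v) <= norm u + norm v.
Proof. by rewrite /norm raddfD ler_normD. Qed.

Let normZ c v : norm (c *: v) = `|c| * norm v.
Proof. by rewrite /norm linearZ normrZ. Qed.

Let norm_eq0 v : norm v = 0 -> v = 0.
Proof.
move=> /eqP; rewrite normr_eq0 => /eqP v0.
by apply: val_inj; rewrite v0 raddf0.
Qed.

HB.instance Definition _ :=
  Lmodule_isNormed.Build K fixed_space norm_triangle normZ norm_eq0.

Let valB (v w : fixed_space) : val (v - w) = val v - val w.
Proof. exact: raddfB. Qed.

Let valZ c (v : fixed_space) : val (c *: v) = c *: val v.
Proof. exact: linearZ. Qed.

Let fixed_normE (v : fixed_space) : `|v| = `|val v|.
Proof. by []. Qed.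

Lemma fixed_normB (v w : fixed_space) : `|v - w| = `|val v - val w|.
Proof. by rewrite -raddfB. Qed.

Lemma proj_fixed (v : fixed_space) : p (val v) = val v.
Proof. by apply/eqP; case: v. Qed.

Definition to_fixed (v : H) : fixed_space :=
  FixedPoint (p v) (introT eqP (orth_proj_idem v)).

(** A limit [y] taken in [H] can be replaced by [p y]: since [p] does not
    increase distances and fixes the points that converge, [p y] is at least as
    close to them as [y]. *)
Lemma fixed_cauchy_cvg (F : set_system fixed_space) :
  ProperFilter F -> cauchy F -> cvg F.
Proof.
move=> FF /cauchyP Fc.
have : cauchy (val @ F : set_system H).
  apply/cauchyP => e e0; have [v Fv] := Fc e e0; exists (val v).
  rewrite /= /nbhs /=; apply: filterS Fv => w.
  by rewrite -!ball_normE /ball_ /= fixed_normB.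
move=> /cauchy_cvg/cvg_ex[y /cvgrPdist_lt Fy].
apply/cvg_ex; exists (to_fixed y); apply/cvgrPdist_lt => e e0.
apply: filterS (Fy e e0) => v; apply: le_lt_trans.
by rewrite fixed_normB /= -{1}(proj_fixed v) -linearB orth_proj_le.
Qed.

HB.instance Definition _ :=
  Uniform_isComplete.Build fixed_space fixed_cauchy_cvg.

Definition fixed_dot (u v : fixed_space) : K := dot (val u) (val v).

Let fixed_dot_additivel v : zmod_morphism (fixed_dot ^~ v).
Proof.
by move=> a b; rewrite /fixed_dot valB; exact: zmod_morphisml_subproof.
Qed.

Let fixed_dot_additiver u : zmod_morphism (fixed_dot u).
Proof. by move=> a b; rewrite /fixed_dot valB; exact: raddfB. Qed.

Let fixed_dot_scalablel v : scalable_for *%R (fixed_dot ^~ v).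
Proof. by move=> c u; rewrite /fixed_dot valZ; exact: linearl_subproof. Qed.

Let fixed_dot_scalabler u : scalable_for (conj \; *%R) (fixed_dot u).
Proof. by move=> c v; rewrite /fixed_dot valZ; exact: linearr_subproof. Qed.

HB.instance Definition _ := isBilinear.Build K fixed_space fixed_space K
  *%R (conj \; *%R) fixed_dot fixed_dot_additivel fixed_dot_additiver
  fixed_dot_scalablel fixed_dot_scalabler.

HB.instance Definition _ := isHermitianSesquilinear.Build K fixed_space false
  conj fixed_dot (fun u v => hermitian_subproof (val u) (val v)).

Let fixed_dot_gt0 u : u != 0 -> 0 < fixed_dot u u.
Proof.
move=> u0; apply: neq0_dnorm_gt0; apply: contra_neq u0 => u0.
by apply: val_inj; rewrite u0 raddf0.
Qed.

HB.instance Definition _ :=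
  isDotProduct.Build K fixed_space fixed_dot fixed_dot_gt0.

Lemma fixed_hilbert : hilbert (fixed_dot : {dot fixed_space for conj}).
Proof. by move=> v; exact: hilbertH. Qed.

(** Why tightness survives the projection: on the range of [p], the inner
    product with [w] does not see the residual [w - p w]. *)
Lemma fixed_dot_to_fixed (v : fixed_space) (w : H) :
  fixed_dot v (to_fixed w) = dot (val v) w.
Proof.
rewrite /fixed_dot /= -[in RHS](subrK (p w) w) dotDr.
by rewrite [X in X + _]dot_sym0 ?add0r// -proj_fixed p_orth.
Qed.

Lemma fixed_finite_dimensional :
  finite_rank p -> finite_dimensional fixed_space.
Proof.
move=> [n [e pe]]; exists n, (to_fixed \o e) => v; have [c pv] := pe (val v).
exists c; apply: val_inj; transitivity (p (p (val v))).
  by rewrite !proj_fixed.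
rewrite pv linear_sum raddf_sum.
by apply: eq_bigr => i _; rewrite linearZ; exact/esym/valZ.
Qed.

(** The finite dimensional property, transported back to [H]: a partition for
    the projected frame is one for the frame itself, as far as vectors fixed by
    [p] are concerned. *)
Lemma fixed_partition {R : realType} {re : K -> R} {A B : R} {J : countType}
    {x : J -> H} {k : R} :
  (forall (J : countType) (x : J -> fixed_space) (k : R),
     in_unit_ball x -> 1 < k -> tight_frame re fixed_dot x k ->
     exists P : set (set J), partition_into_frames re fixed_dot x P A B) ->
  in_unit_ball x -> 1 < k -> tight_frame re dot x k ->
  exists P : set (set J), partition P id [set: J] /\
    forall S, P S -> forall v, p v = v ->
      let t := (\esum_(j in S) (re (`|dot v (x j)| ^+ 2))%:E)%E in
      ((A * re (`|v| ^+ 2))%:E <= t)%E /\ (t <= (B * re (`|v| ^+ 2))%:E)%E.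
Proof.
move=> hfixed x1 k1 [k0 _ xk].
have sumE (v : fixed_space) S :
    (\esum_(j in S) (re (`|fixed_dot v (to_fixed (x j))| ^+ 2))%:E =
     \esum_(j in S) (re (`|dot (val v) (x j)| ^+ 2))%:E)%E.
  by apply: eq_esum => j _; rewrite fixed_dot_to_fixed.
have [| |P [partP frameP]] := hfixed J (to_fixed \o x) k _ k1.
- by move=> j; exact: le_trans (orth_proj_le _) (x1 j).
- by split => // v; rewrite /= sumE; exact: xk.
exists P; split => // S PS v pv; have [_ _ /(_ (to_fixed v))] := frameP S PS.
by rewrite /= sumE /= fixed_normE /= pv.
Qed.

End FixedSpace.

(** * Nonnegative families *)

Section Esum.
Context {R : realType} {J : choiceType} (f : J -> \bar R).
Hypothesis f_ge0 : forall j, (0 <= f j)%E.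

Lemma esum_subset (S T : set J) :
  S `<=` T -> (\esum_(j in S) f j <= \esum_(j in T) f j)%E.
Proof.
move=> ST; apply: le_ereal_sup => _ [F [finF FS] <-].
by exists F => //; split => //; exact: subset_trans ST.
Qed.

(** Disjointness makes the second projection injective on the pairs (block,
    element), which turns the double sum into a sum over a subset of [J]. *)
Lemma trivIset_esum_le (P : set (set J)) : trivIset P id ->
  (\esum_(S in P) \esum_(j in S) f j <= \esum_(j in [set: J]) f j)%E.
Proof.
move=> triP; rewrite esum_esum//.
have snd_inj : set_inj (P `*`` id) snd.
  move=> [S j] [S' j'] /set_mem[/= PS Sj] /set_mem[/= PS' Sj'] jj'.
  move: Sj' => /=; rewrite -jj' => Sj'; congr (_, _).
  by apply: triP => //; exists j.
by rewrite -(@esum_image _ _ _ _ snd f snd_inj) esum_subset.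
Qed.

Lemma finite_partition_esum (P : set (set J)) (c : R) :
  trivIset P id -> 0 < c -> (\esum_(j in [set: J]) f j < +oo)%E ->
  (forall S, P S -> (c%:E <= \esum_(j in S) f j)%E) -> finite_set P.
Proof.
move=> triP c0 foo cP; apply: contrapT => Pinf.
have := trivIset_esum_le _ triP; apply/negP; rewrite -ltNge.
have ffin : (\esum_(j in [set: J]) f j)%E \is a fin_num.
  by rewrite ge0_fin_numE// esum_ge0.
rewrite -(fineK ffin); set t := fine _.
pose n := Num.bound (t / c).
have t_lt : t < c *+ n.
  rewrite -mulr_natl -ltr_pdivrMr//; apply: archi_boundP.
  by rewrite divr_ge0 ?(ltW c0)// fine_ge0// esum_ge0.
have [B BP nB] := infinite_set_fset n Pinf.
apply: (@lt_le_trans _ _ (c *+ n)%:E); first by rewrite lte_fin.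
apply: esum_ge; exists [set` B]; first by split.
rewrite fsbig_finite//= set_fsetK.
apply: (@le_trans _ _ (\sum_(S <- B) c%:E)%E).
  rewrite sumEFin lee_fin big_const_seq count_predT iter_addr_0.
  by rewrite ler_wpMn2l// ltW.
rewrite !big_seq; apply: lee_sum => S SB; exact/cP/BP.
Qed.

Lemma esum_tail (e : R) : (\esum_(j in [set: J]) f j < +oo)%E -> 0 < e ->
  exists2 F : set J, finite_set F & (\esum_(j in ~` F) f j <= e%:E)%E.
Proof.
move=> foo e0.
have ffin : (\esum_(j in [set: J]) f j)%E \is a fin_num.
  by rewrite ge0_fin_numE// esum_ge0.
have [_ [F [finF _] <-] lef] := ub_ereal_sup_adherent e0 ffin.
exists F => //; rewrite -esum_fset// in lef.
move: lef; rewrite -[ereal_sup _]/(esum _ _) (esumID F)// !setTI.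
have Ffin : (\esum_(j in F) f j)%E \is a fin_num.
  by rewrite ge0_fin_numE ?esum_ge0// (le_lt_trans _ foo)// esum_subset.
by rewrite lteBlDr// lteD2lE// => /ltW.
Qed.

End Esum.

(** * Compactness of the set of partitions *)

Section Compactness.
Context {R : realType} {I : eqType} {J : choiceType} (f : I -> J -> \bar R).
Context (a b : I -> R).
Hypotheses (f_ge0 : forall i j, (0 <= f i j)%E)
  (f_summable : forall i, (\esum_(j in [set: J]) f i j < +oo)%E).

Let bounded (S : set J) (i : I) :=
  ((a i)%:E <= \esum_(j in S) f i j)%E /\ (\esum_(j in S) f i j <= (b i)%:E)%E.

(** The filter of the finite subsets of [I], directed by inclusion: along it,
    every [i] belongs to almost all of them. *)
Let final : set_system (seq I) :=
  [set A | exists s0 : seq I, forall s : seq I, {subset s0 <= s} -> A s].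

Let final_proper : ProperFilter final.
Proof.
apply: Build_ProperFilter_ex => [A [s0]|].
  by move=> /(_ s0)A0; exists s0; exact: A0.
split=> [|A B [s As] [t Bt]|A B AB [s As]]; first by exists [::].
  exists (s ++ t) => u su; split; [apply: As|apply: Bt] => i isu; apply: su;
    by rewrite mem_cat isu ?orbT.
by exists s => t /As/AB.
Qed.

(** Two-sided bounds on block sums that hold for partitions adapted to finitely
    many of the families [f i] at a time hold for one partition and all [i].
    The lower bound would be lost in the limit without summability: mass could
    escape to infinity along the blocks. *)
Lemma partition_compactness :
  (forall s : seq I, exists P : set (set J),
     partition P id [set: J] /\
     forall S, P S -> forall i, i \in s -> bounded S i) ->
  exists P : set (set J),
    partition P id [set: J] /\ forall S, P S -> forall i, bounded S i.
Proof.
move=> /choice[P hP].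
have [U [UU finalU]] := @ultraFilterLemma _ final final_proper.
pose lim_rel j j' := U [set s | exists S, [/\ P s S, S j & S j']].
have U_mem i : U [set s : seq I | i \in s].
  by apply: finalU; exists [:: i] => s; apply; exact: mem_head.
have U_ex A : U A -> exists s, A s by exact: filter_ex.
have lim_refl j : lim_rel j j.
  apply: filterE => s; have [[cov _ _] _] := hP s.
  by have : [set: J] j by []; rewrite -cov => -[S PS Sj]; exists S.
have lim_sym j j' : lim_rel j j' -> lim_rel j' j.
  by apply: filterS => s [S [? ? ?]]; exists S.
have lim_trans j k l : lim_rel j k -> lim_rel k l -> lim_rel j l.
  move=> jk kl; apply: filterS (filterI jk kl) => s /=.
  move=> [[S [PS Sj Sk]] [T [PT Tk Tl]]].
  exists S; split=> //; have [[_ tri _] _] := hP s.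
  by rewrite (tri S T)//; exists k.
(* The block of [j] is eventually constant on each finite set of indices. *)
have agree j (F : set J) : finite_set F ->
    U [set s | exists2 S, P s S & S j /\ S `&` F = lim_rel j `&` F].
  move=> /finite_fsetP[{}F ->].
  pose ok k := [set s | (exists S, [/\ P s S, S j & S k]) <-> lim_rel j k].
  have U_ok k : U (ok k).
    have [Uk|Uk] :=
        in_ultra_setVsetC [set s | exists S, [/\ P s S, S j & S k]] UU.
      by apply: filterS (Uk) => s sk; split.
    apply: filterS (Uk) => s sk; split => // jk.
    by have [s' []] := U_ex _ (filterI Uk jk).
  have U_all : U (\bigcap_(k in [set` F]) ok k) by apply: filter_bigI => k _.
  apply: filterS U_all => s s_ok.
  have [S [PS Sj _]] : exists S, [/\ P s S, S j & S j].
    have [[cov _ _] _] := hP s.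
    by have : [set: J] j by []; rewrite -cov => -[S PS Sj]; exists S.
  exists S => //; split => //; apply/funext => k; apply/propext.
  split => -[Sk Fk]; split => //; first by apply/(s_ok k Fk); exists S.
  have /(s_ok k Fk)[T [PT Tj Tk]] := Sk; have [[_ tri _] _] := hP s.
  by rewrite (tri S T)//; exists j.
exists (range lim_rel); split; first split.
- by rewrite eqEsubset; split => // j _; exists (lim_rel j) => //; exists j.
- move=> _ _ [j _ <-] [k _ <-] [l [jl kl]].
  apply/funext => m; apply/propext; split => ?.
    by apply: (lim_trans _ _ _ kl); exact: (lim_trans _ _ _ (lim_sym _ _ jl)).
  by apply: (lim_trans _ _ _ jl); exact: (lim_trans _ _ _ (lim_sym _ _ kl)).
- by move=> _ [j _ <-]; exists j.
move=> _ [j _ <-] i; split.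
  (* What the block for [s] has outside [F] costs at most [e], whatever [s]. *)
  apply/lee_addgt0Pr => e e0.
  have [F finF tailF] := esum_tail (f i) (f_ge0 i) e (f_summable i) e0.
  have [s /= [[S PS [Sj SF]] si]] :=
      U_ex _ (filterI (agree j F finF) (U_mem i)).
  have [_ /(_ S PS i si)[aS _]] := hP s.
  apply: le_trans aS _; rewrite (esumID F)// SF; apply: leeD.
    by apply: esum_subset => // k [].
  by apply: le_trans tailF; apply: esum_subset => // k [].
apply: ge_ereal_sup => _ [F [finF FS] <-].
have [s /= [[S PS [Sj SF]] si]] :=
    U_ex _ (filterI (agree j F finF) (U_mem i)).
have [_ /(_ S PS i si)[_ Sb]] := hP s.
rewrite -esum_fset//; apply: le_trans Sb; apply: esum_subset => // k Fk.
by have [] : (S `&` F) k by rewrite SF; split => //; exact: FS.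
Qed.

End Compactness.

(** * The theorem *)

Lemma re_gt0 {R : realType} {K : numFieldType} {conj : K -> K} {re : K -> R} :
  real_or_complex conj re -> forall z, 0 < z -> 0 < re z.
Proof.
by case=> [//|z]; rewrite ltcE /= => /andP[].
Qed.

Lemma re_ge0 {R : realType} {K : numFieldType} {conj : K -> K} {re : K -> R} :
  real_or_complex conj re -> forall z, 0 <= z -> 0 <= re z.
Proof.
by case=> [//|z]; rewrite lecE /= => /andP[].
Qed.

Theorem corollary1p8 (R : realType) (K : numFieldType) (conj : K -> K)
    (re : K -> R) (hK : real_or_complex conj re)
    (A B : R) (hA : 0 < A) (hB : 0 < B)
    (hfin : forall (V : completeNormedModType K) (dot : {dot V for conj}),
       hilbert dot -> finite_dimensional V ->
       forall (J : countType) (x : J -> V) (k : R),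
       in_unit_ball x -> 1 < k -> tight_frame re dot x k ->
       exists P : set (set J), partition_into_frames re dot x P A B)
    (H : completeNormedModType K) (dot : {dot H for conj}) :
  hilbert dot -> separable H ->
  forall (J : countType) (x : J -> H) (k : R),
  in_unit_ball x -> 1 < k -> tight_frame re dot x k ->
  exists P : set (set J),
    finite_set P /\ partition_into_frames re dot x P A B.
Proof.
move=> hilbertH _ J x k x1 k1 tight.
pose q (v : H) : R := re (`|v| ^+ 2).
pose f (v : H) (j : J) : \bar R := (re (`|dot v (x j)| ^+ 2))%:E.
have f_ge0 v j : (0 <= f v j)%E by rewrite lee_fin (re_ge0 hK)// exprn_ge0.
have [_ _ f_total] := tight.
have f_summable v : (\esum_(j in [set: J]) f v j < +oo)%E.
  by have [_ /le_lt_trans] := f_total v; apply; exact: ltry.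
(* In the zero space all sums vanish and any partition will do; there blocks
   cannot be counted, so the trivial one is chosen, or the empty one if [J] is
   empty. *)
have [v0|H0] := pselect (exists v : H, v != 0); last first.
  have all0 (v : H) : v = 0.
    by apply: contrapT => v0; apply: H0; exists v; exact/eqP.
  exists [set S | S = [set: J] /\ S !=set0]; split.
    by apply: (@sub_finite_set _ _ [set [set: J]]) => // S [].
  split; first split.
  - rewrite eqEsubset; split => // j _.
    by exists [set: J] => //; split => //; exists j.
  - by move=> S T [-> _] [-> _].
  - by move=> S [].
  move=> S [-> _]; split => // v; have := f_total v => /=.
  have -> : re (`|v| ^+ 2) = 0.
    by rewrite (all0 v) normr0 expr0n /=; case: hK.
  by rewrite !mulr0.
have [s|P [partP frameP]] := partition_compactness f
    (fun v => A * q v) (fun v => B * q v) f_ge0 f_summable.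
  have [p [p_orth p_fin ps]] := orth_proj_fixing dot s.
  have [P [partP frameP]] := fixed_partition hilbertH p_orth
    (hfin _ _ (fixed_hilbert hilbertH p_orth)
       (fixed_finite_dimensional hilbertH p_orth p_fin)) x1 k1 tight.
  by exists P; split => // S PS v /ps; exact: frameP.
exists P; split; last by split => // S PS; split => // v; exact: frameP.
have [v vneq0] := v0; have [_ triP _] := partP.
apply: (finite_partition_esum (f v) (f_ge0 v) P (A * q v)) => //.
  by rewrite mulr_gt0// (re_gt0 hK)// exprn_gt0// normr_gt0.
by move=> S PS; have [] := frameP S PS v.
Qed.
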